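(* If $\mathbf{x}$ is an infinite binary word that is $2$-pseudoperiodic, then $\mathbf{x}$ contains a $(7/3)$-power, i.e., $\mathbf{x}$ has a nonempty finite factor $y$ with $\exp(y)\ge 7/3$.
   Context: For integers $0<p_1<p_2$, an infinite word $\mathbf{x}$ (indexed from $0$) has pseudoperiod $(p_1,p_2)$ if $\mathbf{x}[i]\in\{\mathbf{x}[i+p_1],\mathbf{x}[i+p_2]\}$ for all $i\ge0$; it is $2$-pseudoperiodic if it has some such pseudoperiod. The exponent of a nonempty finite word $y$ is $\exp(y)=|y|/p$ where $p$ is the smallest period of $y$ (the least $p\ge1$ with $y[i]=y[i+p]$ for all $0\le i<|y|-p$). *)

(* Defs.v *)
From mathcomp Require Import all_boot all_order all_algebra.

Set Implicit Arguments.
Unset Strict Implicit.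
Unset Printing Implicit Defensive.

Import Order.TTheory GRing.Theory Num.Theory.

Definition infword (T : Type) := nat -> T.

Definition has_pseudoperiod2 (T : Type) (x : infword T) (p1 p2 : nat) : Prop :=
  forall i : nat, x i = x (i + p1) \/ x i = x (i + p2).

Definition pseudoperiodic2 (T : Type) (x : infword T) : Prop :=
  exists p1 p2 : nat, 0 < p1 /\ p1 < p2 /\ has_pseudoperiod2 x p1 p2.

Definition is_factor (T : Type) (y : seq T) (x : infword T) : Prop :=
  exists i : nat, y = mkseq (fun k => x (i + k)) (size y).

(* Both indices are in range below, so [onth] never compares a [None]; when
   [size y <= p] the truncated subtraction makes the condition vacuous. *)
Definition is_period (T : eqType) (y : seq T) (p : nat) : bool :=
  (0 < p) && [forall i : 'I_(size y - p), onth y i == onth y (i + p)].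

Lemma is_period_ex (T : eqType) (y : seq T) : exists p, is_period y p.
Proof.
exists (size y).+1; apply/andP; split=> //; apply/forallP => -[i /= lti].
by exfalso; move: lti; rewrite (eqP (leqnSn (size y))).
Qed.

Definition min_period (T : eqType) (y : seq T) : nat := ex_minn (is_period_ex y).

Definition word_exp (T : eqType) (y : seq T) : rat :=
  ((size y)%:R / (min_period y)%:R)%R.

(* Main.v *)
Require Import Defs.
From mathcomp Require Import all_boot all_order all_algebra.
From mathcomp Require Import zify.
From Stdlib Require Import Classical_Prop.

(** A binary word avoiding (7/3)-powers is, up to a short prefix, the image
    [mu y] of another such word under the Thue-Morse morphism
    [0 -> 01, 1 -> 10].  If both pseudoperiods are even, halving them gives
    pseudoperiods of [y], and one descends.  Otherwise, desubstituting once more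
    ([y = mu z] up to a prefix) turns the pseudoperiodicity into an identity
    [z (j + c) = z (j + d)] with [c != d], or [z (j + c) = ~~ z (j + d)], valid
    for all [j]; so [z] is ultimately periodic and contains a cube. *)

Set Implicit Arguments.
Unset Strict Implicit.
Unset Printing Implicit Defensive.

Import GRing.Theory Num.Theory.

(** * Powers and the Thue-Morse morphism *)

(* The bound says that the factor of period [p] starting at [i] has length at
   least [p + 4p/3 = 7p/3]. *)
Definition power73_at (x : infword bool) (i p : nat) : Prop :=
  0 < p /\ forall k, 3 * k < 4 * p -> x (i + k) = x (i + k + p).

Definition power73_free (x : infword bool) : Prop :=
  forall i p, ~ power73_at x i p.

Definition mu (y : infword bool) : infword bool :=
  fun n => odd n (+) y n./2.

Lemma mu_even y n : mu y (2 * n) = y n.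
Proof. by rewrite /mu mul2n odd_double doubleK. Qed.

Lemma mu_odd y n : mu y (2 * n + 1) = ~~ y n.
Proof. by rewrite /mu mul2n addn1 /= odd_double uphalf_double. Qed.

Lemma nat_parity n : exists m, n = 2 * m \/ n = 2 * m + 1.
Proof. by exists (n./2); lia. Qed.

Lemma power73_free_shift x y s :
  (forall n, x (s + n) = y n) -> power73_free x -> power73_free y.
Proof.
move=> xy fx i p [p0 H]; apply: (fx (s + i) p); split=> // k /H.
by rewrite -!xy !addnA.
Qed.

(** [mu] doubles both the length and the period of a power, so it keeps the exponent. *)
Lemma power73_free_mu y : power73_free (mu y) -> power73_free y.
Proof.
move=> fx i p [p0 H]; apply: (fx (2 * i) (2 * p)); split=> [|k hk]; first lia.
have [m [km|km]] := nat_parity k.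
- have -> : 2 * i + k + 2 * p = 2 * (i + m + p) by lia.
  have -> : 2 * i + k = 2 * (i + m) by lia.
  by rewrite !mu_even; apply: H; lia.
- have -> : 2 * i + k + 2 * p = 2 * (i + m + p) + 1 by lia.
  have -> : 2 * i + k = 2 * (i + m) + 1 by lia.
  by rewrite !mu_odd H //; lia.
Qed.

(** * Desubstitution of (7/3)-power-free words *)

Section Desubstitution.

Variables (x : infword bool) (fx : power73_free x).

Lemma no_cube n : x n = x (n + 1) -> x (n + 1) = x (n + 2) -> False.
Proof.
move=> h0 h1; apply: (fx (i := n) (p := 1)); split=> // -[|[|k]] hk.
- by rewrite addn0.
- by rewrite -addnA.
- lia.
Qed.

Lemma no_overlap5 n :
  x n = x (n + 2) -> x (n + 1) = x (n + 3) -> x (n + 2) = x (n + 4) -> False.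
Proof.
move=> h0 h1 h2; apply: (fx (i := n) (p := 2)).
split=> // -[|[|[|k]]] hk; rewrite -?addnA ?addn0 //; lia.
Qed.

Lemma no_period3_7 n :
  x n = x (n + 3) -> x (n + 1) = x (n + 4) -> x (n + 2) = x (n + 5) ->
  x (n + 3) = x (n + 6) -> False.
Proof.
move=> h0 h1 h2 h3; apply: (fx (i := n) (p := 3)).
split=> // -[|[|[|[|k]]]] hk; rewrite -?addnA ?addn0 //; lia.
Qed.

(* Two equal pairs at distance 3 form [aabaa]; any two-sided extension of it
   contains a cube or the (7/3)-power [baabaab]. *)
Lemma no_square_dist3 n : 0 < n ->
  x n = x (n + 1) -> x (n + 3) = x (n + 4) -> False.
Proof.
(* [0 < n] supplies the letter to the left: after the shift, [aabaa] occupies positions [n + 1] to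
   [n + 5]. *)
case: n => // n _; rewrite -addn1 -!addnA => h0 h3.
have := @no_cube n; have := @no_cube (n + 1); have := @no_cube (n + 2).
have := @no_cube (n + 3); have := @no_cube (n + 4); have := @no_period3_7 n.
rewrite -!addnA; move: h0 h3.
case: (x n); case: (x (n + 1)); case: (x (n + 2)); case: (x (n + 3));
  case: (x (n + 4)); case: (x (n + 5)); case: (x (n + 6)) => //=; by auto.
Qed.

Lemma square_within4 n :
  x n <> x (n + 1) -> x (n + 1) <> x (n + 2) -> x (n + 2) <> x (n + 3) ->
  x (n + 3) <> x (n + 4) -> False.
Proof.
have := @no_overlap5 n.
case: (x n); case: (x (n + 1)); case: (x (n + 2)); case: (x (n + 3));
  case: (x (n + 4)) => //=; by auto.
Qed.

(** After an equal pair the next one starts 2 or 4 places later: distance 1 gives a cube, distance 3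
    is excluded, and with none up to distance 4 the factor [ababa] appears. So all later pairs start
    at positions of the same parity. *)
Lemma square_parity m n : 0 < n -> x n = x (n + 1) ->
  x (n + 1 + 2 * m) <> x (n + 1 + 2 * m + 1).
Proof.
elim/ltn_ind: m n => m IH n n0 En.
have N1 : x (n + 1) <> x (n + 2) by move=> /(no_cube En).
have N3 : x (n + 3) <> x (n + 4) by move=> /(no_square_dist3 n0 En).
case: m IH => [|[|m]] IH.
- by rewrite muln0 addn0 -addnA.
- by rewrite -!addnA.
- have [E2|N2] := eqVneq (x (n + 2)) (x (n + 3)).
    have -> : n + 1 + 2 * m.+2 = n + 2 + 1 + 2 * m.+1 by lia.
    by apply: IH; rewrite -?addnA //; lia.
  have [E4|N4] := eqVneq (x (n + 4)) (x (n + 5)).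
    have -> : n + 1 + 2 * m.+2 = n + 4 + 1 + 2 * m by lia.
    by apply: IH; rewrite -?addnA //; lia.
  exfalso; apply: (@square_within4 (n + 1)); rewrite -!addnA //; exact/eqP.
Qed.

Lemma exists_square : exists2 n, 0 < n & x n = x (n + 1).
Proof.
have [E|/eqP N1] := eqVneq (x 1) (x 2); first by exists 1.
have [E|/eqP N2] := eqVneq (x 2) (x 3); first by exists 2.
have [E|/eqP N3] := eqVneq (x 3) (x 4); first by exists 3.
have [E|/eqP N4] := eqVneq (x 4) (x 5); first by exists 4.
by case: (@square_within4 1).
Qed.

Lemma desubstitution :
  exists s y, (forall n, x (s + n) = mu y n) /\ power73_free y.
Proof.
have [n n0 En] := exists_square.
(* Cutting inside an equal pair ensures that no block of length 2 is itself such a pair. *)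
pose y m := x (n + 1 + 2 * m).
have xy k : x (n + 1 + k) = mu y k.
  have [m [->|->]] := nat_parity k; first by rewrite mu_even.
  rewrite mu_odd /y addnA; have := square_parity (m := m) n0 En.
  by case: (x _); case: (x _).
exists (n + 1), y; split=> //; apply: power73_free_mu.
exact: power73_free_shift xy fx.
Qed.

End Desubstitution.

(** * Shift identities excluded by power-freeness *)

Lemma power73_free_not_periodic z c d : power73_free z -> c <> d ->
  ~ (forall j, z (j + c) = z (j + d)).
Proof.
move=> fz; wlog lt_cd : c d / c < d => [W|] cd H.
  have [lt|le] := ltnP c d; first exact: (W c d).
  by apply: (W d c) => //; lia.
apply: (fz c (d - c)); split=> [|k _]; first lia.
by rewrite addnC H; congr z; lia.
Qed.

(** Using the identity twice cancels the negations and leaves a periodicity. *)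
Lemma power73_free_not_antiperiodic z c d : power73_free z ->
  ~ (forall j, z (j + c) = ~~ z (j + d)).
Proof.
move=> fz H; have [cd|/eqP cd] := eqVneq c d.
  by have := H 0; rewrite cd; case: (z _).
apply: (@power73_free_not_periodic z (c + c) (d + d)) => //; first lia.
move=> j; rewrite addnA H.
have -> : j + c + d = j + d + c by lia.
by rewrite H negbK addnA.
Qed.

(** * Pseudoperiods that are not both even *)

Lemma mixed_parity_contradiction y a b :
  power73_free y -> 0 < b ->
  ~ has_pseudoperiod2 (mu y) (2 * a + 1) (2 * b).
Proof.
move=> fy b0 H.
(* If [b] fails at [i], both letters of block [i] must match across the odd shift, which lands in
   blocks [i + a] and [i + a + 1]. *)
have K i : y i <> y (i + b) -> y (i + a) = y (i + a + 1).
  have h0 := H (2 * i); have h1 := H (2 * i + 1); move: h0 h1.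
  have -> : 2 * i + 1 + (2 * a + 1) = 2 * (i + a + 1) by lia.
  have -> : 2 * i + 1 + 2 * b = 2 * (i + b) + 1 by lia.
  have -> : 2 * i + (2 * a + 1) = 2 * (i + a) + 1 by lia.
  have -> : 2 * i + 2 * b = 2 * (i + b) by lia.
  rewrite !mu_even !mu_odd.
  by case: (y i); case: (y (i + a)); case: (y (i + b)); case: (y (i + a + 1))
     => // -[h0|h0] // [h1|h1] // [].
have [t [z [yz fz]]] := desubstitution fy.
(* Blocks of [mu z] are never squares, so [b] is a period at positions [i]
   with [i + a] even. *)
have P i m : i + a = 2 * m -> mu z i = mu z (i + b).
  move=> im; apply/eqP/negPn/negP=> /eqP; rewrite -!yz addnA => /K.
  rewrite -!addnA !yz addnA im mu_even mu_odd; by case: (z m).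
(* The parity of [a] fixes which place of each block [P] reads; that of [b] decides between a
   periodicity and an antiperiodicity of [z]. *)
have [e [ae|ae]] := nat_parity a; have [c [bc|bc]] := nat_parity b.
- apply: (@power73_free_not_periodic z 0 c) => // [|j]; first lia.
  have := P (2 * j) (j + e); have -> : 2 * j + b = 2 * (j + c) by lia.
  by rewrite !mu_even addn0; apply; lia.
- apply: (@power73_free_not_antiperiodic z 0 c) => // j.
  have := P (2 * j) (j + e); have -> : 2 * j + b = 2 * (j + c) + 1 by lia.
  by rewrite mu_even mu_odd addn0; apply; lia.
- apply: (@power73_free_not_periodic z 0 c) => // [|j]; first lia.
  have := P (2 * j + 1) (j + e + 1).
  have -> : 2 * j + 1 + b = 2 * (j + c) + 1 by lia.
  by rewrite !mu_odd addn0 => h; apply: negb_inj; apply: h; lia.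
- apply: (@power73_free_not_antiperiodic z 0 (c + 1)) => // j.
  have := P (2 * j + 1) (j + e + 1).
  have -> : 2 * j + 1 + b = 2 * (j + (c + 1)) by lia.
  by rewrite mu_even mu_odd addn0 => <-; [rewrite negbK | lia].
Qed.

(** What two odd pseudoperiods of [mu y] impose on [y]: an odd shift exchanges the two places of a
    block, which turns equality into difference. *)
Definition antiperiod2 (y : infword bool) (a b : nat) : Prop :=
  forall i, y i <> y (i + a) \/ y i <> y (i + b).

Lemma antiperiod2_even_odd z c d : power73_free z ->
  antiperiod2 (mu z) (2 * c) (2 * d + 1) ->
  antiperiod2 (mu z) (2 * c + 1) (2 * d + 2) -> False.
Proof.
move=> fz A B.
(* [A] at odd and [B] at even positions give the equality; the other two instances give the
   implication. *)
have K j : z (j + c) = z (j + d + 1) /\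
    (z j = z (j + c) -> z (j + d) = z j /\ z (j + c + 1) = z j).
  have := A (2 * j); have := A (2 * j + 1).
  have := B (2 * j); have := B (2 * j + 1).
  have -> : 2 * j + 1 + (2 * c + 1) = 2 * (j + c + 1) by lia.
  have -> : 2 * j + 1 + (2 * d + 2) = 2 * (j + d + 1) + 1 by lia.
  have -> : 2 * j + (2 * c + 1) = 2 * (j + c) + 1 by lia.
  have -> : 2 * j + (2 * d + 2) = 2 * (j + d + 1) by lia.
  have -> : 2 * j + 1 + 2 * c = 2 * (j + c) + 1 by lia.
  have -> : 2 * j + 1 + (2 * d + 1) = 2 * (j + d + 1) by lia.
  have -> : 2 * j + 2 * c = 2 * (j + c) by lia.
  have -> : 2 * j + (2 * d + 1) = 2 * (j + d) + 1 by lia.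
  rewrite !mu_even !mu_odd.
  by case: (z j); case: (z (j + c)); case: (z (j + d)); case: (z (j + c + 1));
     case: (z (j + d + 1)) => // -[h0|h0] // [h1|h1] // [h2|h2] // [h3|h3].
have [cd|/eqP cd] := eqVneq c (d + 1); last first.
  by apply: (power73_free_not_periodic fz cd) => j; rewrite addnA; case: (K j).
(* Here the identity is void, but [z j = z (j + c)] would put a cube at
   [j + d]. *)
apply: (@power73_free_not_antiperiodic z 0 c) => // j; rewrite addn0.
have [_] := K j; have := @no_cube _ fz (j + d).
rewrite cd -!addnA -[1 + 1]/2.
by case: (z j); case: (z (j + d)); case: (z (j + (d + 1)));
  case: (z (j + (d + 2))) => //= h1 h2; exfalso; auto; case: h2.
Qed.

Lemma antiperiod2_sym y a b : antiperiod2 y a b -> antiperiod2 y b a.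
Proof. by move=> H i; case: (H i); auto. Qed.

Lemma both_odd_contradiction y a b :
  power73_free y -> a <> b ->
  ~ has_pseudoperiod2 (mu y) (2 * a + 1) (2 * b + 1).
Proof.
move=> fy ab H.
have A : antiperiod2 y a b.
  move=> i; have := H (2 * i).
  have E c : 2 * i + (2 * c + 1) = 2 * (i + c) + 1 by lia.
  rewrite !E !mu_even !mu_odd.
  by case: (y i); case: (y (i + a)); case: (y (i + b)) => -[] //; auto.
have B : antiperiod2 y (a + 1) (b + 1).
  move=> i; have := H (2 * i + 1).
  have E c : 2 * i + 1 + (2 * c + 1) = 2 * (i + (c + 1)) by lia.
  rewrite !E !mu_even !mu_odd.
  by case: (y i); case: (y (i + (a + 1))); case: (y (i + (b + 1))) => -[] //;
     auto.
have [t [z [yz fz]]] := desubstitution fy.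
have S c d : antiperiod2 y c d -> antiperiod2 (mu z) c d.
  by move=> C i; have := C (t + i); rewrite -!addnA !yz.
move/S: A => A; move/S: B => B {S}.
have [c [ac|ac]] := nat_parity a; have [d [bd|bd]] := nat_parity b; subst.
(* For [a] and [b] of equal parity, one of [A], [B] says that some shift changes [z j], the other
   that some shift preserves it; hence the two shifted letters differ. *)
- apply: (@power73_free_not_antiperiodic z c d) => // j.
  have := A (2 * j); have := B (2 * j).
  have E e : 2 * j + 2 * e = 2 * (j + e) by lia.
  have E' e : 2 * j + (2 * e + 1) = 2 * (j + e) + 1 by lia.
  rewrite !E !E' !mu_even !mu_odd.
  by case: (z j); case: (z (j + c)); case: (z (j + d)) =>
    // -[h0|h0] // [h1|h1].
- by apply: (antiperiod2_even_odd fz A); rewrite -addnA in B.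
- apply: (antiperiod2_even_odd fz (antiperiod2_sym A)).
  by apply: antiperiod2_sym; rewrite -addnA in B.
- apply: (@power73_free_not_antiperiodic z (c + 1) (d + 1)) => // j.
  have := A (2 * j + 1); have := B (2 * j + 1).
  have E e : 2 * j + 1 + (2 * e + 1) = 2 * (j + (e + 1)) by lia.
  have E' e : 2 * j + 1 + (2 * e + 1 + 1) = 2 * (j + (e + 1)) + 1 by lia.
  rewrite !E !E' !mu_even !mu_odd.
  by case: (z j); case: (z (j + (c + 1))); case: (z (j + (d + 1))) =>
    // -[h0|h0] // [h1|h1].
Qed.

Lemma has_pseudoperiod2_sym (T : Type) (x : infword T) p q :
  has_pseudoperiod2 x p q -> has_pseudoperiod2 x q p.
Proof. by move=> H i; case: (H i); auto. Qed.

(** * Descent on the pseudoperiods *)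

Lemma power73_free_not_pseudoperiodic2 p q x :
  0 < p -> 0 < q -> p <> q -> power73_free x -> ~ has_pseudoperiod2 x p q.
Proof.
elim/ltn_ind: p q x => p IH q x p0 q0 pq fx H.
have [s [y [xy fy]]] := desubstitution fx.
have {}H : has_pseudoperiod2 (mu y) p q.
  by move=> i; have := H (s + i); rewrite -!addnA !xy.
have [a [pa|pa]] := nat_parity p; have [b [qb|qb]] := nat_parity q; subst.
- apply: (IH a _ b y) => //; try lia.
  by move=> i; have := H (2 * i); rewrite -!(mulnDr 2) !mu_even.
- apply: (@mixed_parity_contradiction y b a) => //; first lia.
  exact: has_pseudoperiod2_sym.
- by apply: (@mixed_parity_contradiction y a b) => //; lia.
- by apply: (@both_odd_contradiction y a b) => //; lia.
Qed.

(** * From positions to exponents of factors *)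

Lemma power73_at_factor x i p : power73_at x i p ->
  exists y : seq bool,
    y <> [::] /\ is_factor y x /\ (7%:R / 3%:R <= word_exp y)%R.
Proof.
(* [(4 * p + 2) %/ 3] is the ceiling of 4p/3, the number of [k] covered by [power73_at]. *)
case=> p0 H; pose L := p + (4 * p + 2) %/ 3.
pose y := mkseq (fun k => x (i + k)) L.
have szy : size y = L by rewrite size_mkseq.
exists y; split; [|split].
- by move=> y0; move: szy; rewrite y0 /L /=; lia.
- by exists i; rewrite szy.
have per : is_period y p.
  rewrite /is_period p0 /=; apply/forallP => -[k /=]; rewrite szy => hk.
  rewrite !onthE !(nth_map false) ?szy; try by rewrite /L; lia.
  rewrite !nth_mkseq; try by rewrite /L; lia.
  by rewrite addnA H //; move: hk; rewrite /L; lia.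
rewrite /word_exp szy /min_period; case: ex_minnP => m /andP[m0 _] /(_ p per) mp.
(* The least period [m] is at most [p], and [L] is at least 7p/3. *)
have h : 7 * m <= L * 3 by rewrite /L; lia.
rewrite ler_pdivrMr ?ltr0n // mulrAC ler_pdivlMr ?ltr0n //.
by rewrite -!natrM ler_nat.
Qed.

Theorem theorem30 (x : infword bool) (hx : pseudoperiodic2 x) :
  exists y : seq bool,
    y <> [::] /\ is_factor y x /\ (7%:R / 3%:R <= word_exp y)%R.
Proof.
case: hx => p1 [p2 [p1_gt0 [p12 H]]].
have [[i [p xip]]|N] := classic (exists i p, power73_at x i p).
  exact: power73_at_factor xip.
exfalso; apply: (@power73_free_not_pseudoperiodic2 p1 p2 x) => //; try lia.
by move=> i p xip; apply: N; exists i, p.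
Qed.
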